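(* Let $k\ge 1$ be an integer. Define a function $C:\mathbb{Z}^2\to\mathbb{Z}$ as follows. For $(x,y)$ with $x<0$ or $y<0$ set $$C(x,y)=\begin{cases} k & \text{if } x<0 \text{ and } y<0,\\ 0 & \text{if } x<0 \text{ and } y\ge 0,\\ 0 & \text{if } x\ge 0 \text{ and } y<0.\end{cases}$$ For $x,y\ge 0$ define $C(x,y)$ recursively (e.g. by induction on $x+y$) by $$C(x,y)=a-b-c+e+f+p,$$ where $a=C(x-2,y-2)$, $b=C(x-2,y-1)$, $c=C(x-1,y-2)$, $d=C(x-1,y-1)$, $e=C(x-1,y)$, $f=C(x,y-1)$, and $$p=3\,[a<0]-2\,[b<0]-2\,[c<0]-[d<0]+[e<0]+[f<0],$$ with $[\cdot]$ denoting the Iverson bracket ($1$ if the condition holds, $0$ otherwise). Then for all nonnegative integers $x,y$, the position $(x,y)$ of $k$-Blocking Wythoff Nim is a P-position if and only if $C(x,y)<0$.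
   Context: $k$-Blocking Wythoff Nim (for a fixed integer $k\ge1$): positions are pairs $(x,y)$ of nonnegative integers (two heap sizes, equivalently the position of a queen on a quadrant chessboard). The options of $(x,y)$ are the positions $(x-t,y)$, $(x,y-t)$, $(x-t,y-t)$ for integers $t\ge 1$ with all coordinates remaining nonnegative. Two players alternate turns. On each turn the mover chooses an option of the current position, but before doing so the opponent (the player who made the previous move) may designate up to $k-1$ of the options as blocked, and the mover must choose a non-blocked option. A player who has no available (non-blocked) option loses. A position $(x,y)$ is a P-position if the player who moves the game into $(x,y)$ (and who then gets to block up to $k-1$ options of $(x,y)$) has a winning strategy. Equivalently, the set $P$ of P-positions is characterized by: $(x,y)\in P$ if and only if fewer than $k$ of the options of $(x,y)$ belong to $P$. *)

(* Defs.v *)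
From mathcomp Require Import all_boot all_order all_algebra.
From mathcomp Require Import zify.

Set Implicit Arguments.
Unset Strict Implicit.
Unset Printing Implicit Defensive.

Import Order.TTheory GRing.Theory Num.Theory.

Local Open Scope ring_scope.

Definition position : Type := (nat * nat)%type.

Inductive is_option : position -> position -> Prop :=
| option_left (x y t : nat) :
    (1 <= t)%N -> (t <= x)%N -> is_option (x, y) ((x - t)%N, y)
| option_down (x y t : nat) :
    (1 <= t)%N -> (t <= y)%N -> is_option (x, y) (x, (y - t)%N)
| option_diag (x y t : nat) :
    (1 <= t)%N -> (t <= x)%N -> (t <= y)%N ->
    is_option (x, y) ((x - t)%N, (y - t)%N).

(* B lists the blocked options; repetitions are allowed, so B denotes a set of
   at most [size B] options. *)
Definition legal_block (k : nat) (v : position) (B : seq position) : Prop :=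
  (size B <= k - 1)%N /\ (forall w, w \in B -> is_option v w).

(* [P_position k v]: the player who has just moved to v, and who now blocks,
   has a winning strategy.  [N_position k v]: the player about to move from v,
   against any block chosen by the opponent, has a winning strategy.  Since
   every play is finite, winning strategies are exactly the well-founded trees
   captured by the mutual induction; a mover with no unblocked option loses,
   which is the vacuous case of the first constructor. *)
Inductive P_position (k : nat) : position -> Prop :=
| P_intro (v : position) (B : seq position) :
    legal_block k v B ->
    (forall w, is_option v w -> w \notin B -> N_position k w) ->
    P_position k v
with N_position (k : nat) : position -> Prop :=
| N_intro (v : position) :
    (forall B, legal_block k v B ->
       exists w, [/\ is_option v w, w \notin B & P_position k w]) ->
    N_position k v.

Definition iverson (b : bool) : int := (nat_of_bool b)%:Z.

Definition CA_boundary (k : nat) (x y : int) : int :=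
  if (x < 0) && (y < 0) then k%:Z else 0.

Definition CA_rule (C : int -> int -> int) (x y : int) : int :=
  let a := C (x - 2) (y - 2) in
  let b := C (x - 2) (y - 1) in
  let c := C (x - 1) (y - 2) in
  let d := C (x - 1) (y - 1) in
  let e := C (x - 1) y in
  let f := C x (y - 1) in
  let p := 3 * iverson (a < 0) - 2 * iverson (b < 0) - 2 * iverson (c < 0)
           - iverson (d < 0) + iverson (e < 0) + iverson (f < 0) in
  a - b - c + e + f + p.

(* The recursion on x + y is carried by the fuel n; [CA_rec] below shows that
   the initial fuel chosen in [CA] is never exhausted. *)
Fixpoint CA_fuel (k n : nat) (x y : int) : int :=
  if (x < 0) || (y < 0) then CA_boundary k x y
  else if n is n'.+1 then CA_rule (CA_fuel k n') x y else 0.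

Definition CA (k : nat) (x y : int) : int :=
  CA_fuel k (`|x| + `|y|).+1 x y.

Lemma CA_neg_neg (k : nat) (x y : int) : x < 0 -> y < 0 -> CA k x y = k%:Z.
Proof. by rewrite /CA /= /CA_boundary => -> ->. Qed.

Lemma CA_neg_nonneg (k : nat) (x y : int) : x < 0 -> 0 <= y -> CA k x y = 0.
Proof.
by move=> x0 y0; rewrite /CA /= /CA_boundary x0 /= ltNge y0.
Qed.

Lemma CA_nonneg_neg (k : nat) (x y : int) : 0 <= x -> y < 0 -> CA k x y = 0.
Proof.
by move=> x0 y0; rewrite /CA /= /CA_boundary y0 orbT ltNge x0.
Qed.

Lemma CA_fuel_indep (k n m : nat) (x y : int) :
  x + y < n%:Z -> x + y < m%:Z -> CA_fuel k n x y = CA_fuel k m x y.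
Proof.
elim: n m x y => [|n IHn] [|m] x y hn hm //=.
- by case: ifP => // h; exfalso; lia.
- by case: ifP => // h; exfalso; lia.
- case: ifP => // h; rewrite /CA_rule.
  by rewrite !(IHn m) //; lia.
Qed.

Lemma CA_rec (k : nat) (x y : int) :
  0 <= x -> 0 <= y -> CA k x y = CA_rule (CA k) x y.
Proof.
move=> x0 y0; rewrite {1}/CA /= !ltNge x0 y0 /= /CA_rule /CA.
have E u v : u <= x -> v <= y -> u + v < x + y ->
    CA_fuel k (`|x| + `|y|) u v = CA_fuel k (`|u| + `|v|).+1 u v.
  by move=> *; apply: CA_fuel_indep; lia.
by rewrite !E //; lia.
Qed.

(* Main.v *)
Require Import Defs.
From mathcomp Require Import all_boot all_order all_algebra.
From mathcomp Require Import zify.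

(** Let [P] be the indicator of the negative cells of the quadrant and let [V]
    be the number of [P]-options, that is the sum of [P] over the row, the
    column and the diagonal behind a cell.  With the shifts [X], [Y] of the two
    coordinates, these three sums are annihilated up to source terms by [1 - X],
    [1 - Y] and [1 - XY], so the product
      [(1 - X)(1 - Y)(1 - XY) = 1 - X - Y + X^2 Y + X Y^2 - X^2 Y^2]
    applied to [V] is a combination of shifts of [P], and it is exactly the
    perturbation [p] of the rule.  The boundary values make the rule produce the
    constant [-k] in the absence of sources.  Hence [C = V - k] on the
    quadrant, and [C < 0] says that fewer than [k] options satisfy [C < 0]. *)

Local Open Scope ring_scope.

Section Options.

(** Built by structural recursion, so that the list of the next cell along the line is the tail of
    this one. *)
Fixpoint row_options (x y : nat) : seq position :=
  if x is x'.+1 then (x', y) :: row_options x' y else [::].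

Fixpoint column_options (x y : nat) : seq position :=
  if y is y'.+1 then (x, y') :: column_options x y' else [::].

Fixpoint diagonal_options (x y : nat) : seq position :=
  match x, y with
  | x'.+1, y'.+1 => (x', y') :: diagonal_options x' y'
  | _, _ => [::]
  end.

Definition options (v : position) : seq position :=
  row_options v.1 v.2 ++ column_options v.1 v.2 ++ diagonal_options v.1 v.2.

Lemma mem_row_options (x y : nat) (w : position) :
  (w \in row_options x y) = (w.1 < x)%N && (w.2 == y).
Proof.
case: w => i j /=; elim: x => [|x IHx] //=.
by rewrite in_cons IHx xpair_eqE; lia.
Qed.

Lemma mem_column_options (x y : nat) (w : position) :
  (w \in column_options x y) = (w.1 == x) && (w.2 < y)%N.
Proof.
case: w => i j /=; elim: y => [|y IHy] /=; first by rewrite andbF.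
by rewrite in_cons IHy xpair_eqE; lia.
Qed.

Lemma mem_diagonal_options (x y : nat) (w : position) :
  (w \in diagonal_options x y) = (w.1 < x)%N && (w.1 + y == w.2 + x)%N.
Proof.
case: w => i j /=; elim: x y => [|x IHx] [|y] //=.
  by rewrite in_nil; lia.
by rewrite in_cons IHx xpair_eqE; lia.
Qed.

Lemma mem_options (v w : position) : w \in options v <-> is_option v w.
Proof.
case: v w => x y [i j].
rewrite !mem_cat mem_row_options mem_column_options mem_diagonal_options /=.
split=> [/or3P[/andP[hi /eqP->]|/andP[/eqP-> hj]|/andP[hi /eqP e]]|h].
- have -> : i = (x - (x - i))%N by lia.
  by apply: option_left; lia.
- have -> : j = (y - (y - j))%N by lia.
  by apply: option_down; lia.
- have -> : i = (x - (x - i))%N by lia.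
  have -> : j = (y - (x - i))%N by lia.
  by apply: option_diag; lia.
- by inversion h; lia.
Qed.

Lemma uniq_options (v : position) : uniq (options v).
Proof.
case: v => x y; rewrite /options /= !cat_uniq; apply/and5P; split.
- by elim: x => [|x IHx] //=; rewrite IHx mem_row_options /=; lia.
- apply/hasPn => -[i j] /=.
  by rewrite mem_cat mem_row_options mem_column_options mem_diagonal_options /=; lia.
- by elim: y => [|y IHy] //=; rewrite IHy mem_column_options /=; lia.
- apply/hasPn => -[i j] /=.
  by rewrite mem_column_options mem_diagonal_options /=; lia.
- elim: x y => [|x IHx] [|y] //=.
  by rewrite IHx mem_diagonal_options /=; lia.
Qed.

Lemma is_option_decr (v w : position) :
  is_option v w -> (w.1 + w.2 < v.1 + v.2)%N.
Proof. by case=> x y t /=; lia. Qed.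

End Options.

Section Game.

Variable k : nat.

(** Playing the two strategies against each other reaches an option with the same conflict and a
    smaller heap sum. *)
Lemma P_N_exclusive (v : position) : P_position k v -> N_position k v -> False.
Proof.
have [n] := ubnP (v.1 + v.2)%N; elim: n v => // n IHn v ltvn Pv Nv.
case: Pv Nv ltvn => {}v B legalB NB Nv ltvn.
case: Nv NB legalB ltvn => {}v Nv NB legalB ltvn.
have [w [vw wB Pw]] := Nv B legalB.
have ltwv := is_option_decr _ _ vw.
by apply: (IHn w) => //; [lia | apply: NB].
Qed.

Lemma P_position_kernel (q : pred position) : (0 < k)%N ->
  (forall v, q v = (count q (options v) < k)%N) ->
  forall v, P_position k v <-> q v.
Proof.
move=> k_gt0 qE v.
suff [qP qN] : (q v -> P_position k v) /\ (~~ q v -> N_position k v).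
  by split=> // Pv; apply/negPn/negP => /qN; apply: P_N_exclusive Pv.
have [n] := ubnP (v.1 + v.2)%N; elim: n v => // n IHn v ltvn.
have IH w : is_option v w ->
    (q w -> P_position k w) /\ (~~ q w -> N_position k w).
  by move=> /is_option_decr ltwv; apply: IHn; lia.
split=> qv.
(* Block every option in [q]: there are at most [k - 1] of them. *)
- apply: (@P_intro k v (filter q (options v))).
    split; first by rewrite size_filter; move: qv; rewrite qE; lia.
    by move=> w; rewrite mem_filter => /andP[_ /mem_options].
  move=> w vw; rewrite mem_filter negb_and => /orP[nqw|].
    by apply: (IH w vw).2.
  by move/negP; case; apply/mem_options.
- apply: N_intro => B [sizeB _].
  (* Pigeonhole: the options in [q] are distinct and at least [k] in number, so [B] misses one. *)
  have /allPn[w] : ~~ all (mem B) (filter q (options v)).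
    apply/negP => /allP /(uniq_leq_size (filter_uniq q (uniq_options v))).
    move=> lekB; have {lekB} := leq_trans lekB sizeB.
    by rewrite size_filter subn1 -ltnS prednK // -qE (negbTE qv).
  rewrite mem_filter => /andP[qw /mem_options vw] wB.
  by exists w; split=> //; apply: (IH w vw).1.
Qed.

End Game.

Section Automaton.

Variable k : nat.

Definition negative_cell (v : position) : bool := CA k v.1%:Z v.2%:Z < 0.

Lemma CA_count_options (x y : nat) :
  CA k x%:Z y%:Z = (count negative_cell (options (x, y)))%:Z - k%:Z.
Proof.
have [n] := ubnP (x + y)%N; elim: n x y => // n IHn x y ltn.
have IH i j : (i + j < x + y)%N ->
    CA k i%:Z j%:Z = (count negative_cell (options (i, j)))%:Z - k%:Z.
  by move=> ltij; apply: IHn; lia.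
have foldP i j : iverson (CA k i%:Z j%:Z < 0) = (negative_cell (i, j) : nat)%:Z.
  by [].
have bd_nn i j : CA k (Negz i) (Negz j) = k%:Z by rewrite CA_neg_neg.
have bd_np i (j : nat) : CA k (Negz i) j%:Z = 0 by rewrite CA_neg_nonneg.
have bd_pn (i : nat) j : CA k i%:Z (Negz j) = 0 by rewrite CA_nonneg_neg.
have sub1 (m : nat) : m.+1%:Z - 1 = m%:Z by lia.
have sub2 (m : nat) : m.+2%:Z - 2 = m%:Z by lia.
(* [Negz n] is [-(n + 1)]; this form lets the boundary equations match. *)
have out01 : 0%:Z - 1 = Negz 0 by [].
have out02 : 0%:Z - 2 = Negz 1 by [].
have out12 : 1%:Z - 2 = Negz 0 by [].
rewrite CA_rec // /CA_rule.
(* The rule looks back at most two steps, so 0, 1 or at least 2 in each coordinate settles which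
   neighbours leave the quadrant. Unfolded, the counts share tails, which cancel linearly. *)
case: x y {ltn} IH => [|[|x]] [|[|y]] IH;
  rewrite ?(sub1, sub2, out01, out02, out12) ?(bd_nn, bd_np, bd_pn) ?foldP;
  by rewrite ?IH ?/options ?count_cat /= ?/iverson; lia.
Qed.

End Automaton.

Theorem theorem1 (k : nat) (hk : (1 <= k)%N) (x y : nat) :
  P_position k (x, y) <-> CA k x%:Z y%:Z < 0.
Proof.
apply: (@P_position_kernel k (negative_cell k) hk) => -[i j].
by rewrite {1}/negative_cell CA_count_options Num.Theory.subr_lt0 ltz_nat.
Qed.
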